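(* Let $(a,b,m,n)\in\mathcal Q$ with $n=a$, let $\mathbf d$ be a positive integer, and let $F,G\in\overline{\mathcal R}=\mathbb C[x^{\pm1/\mathbf d}][y]$ be such that (1) $[F,G]\in\mathbb C\setminus\{0\}$; (2) $F\in\overline T_{m,n;a,b}$ and $G\in\overline T_{bm/a,\,bn/a;\,b,a}$; (3) $N^0(F)$ is similar to $N^0(G)$ with the origin as center of similarity and with ratio $\deg(F):\deg(G)=a:b$ (so $N^0(G)=\frac ba N^0(F)$). Then $(\frac{a}{a+b},0)\notin N^0(F)$ and $(\frac{b}{a+b},0)\notin N^0(G)$.
   Context: $\mathcal Q=\{(a,b,m,n)\in\mathbb Z_{>0}^4 : a\mid m,\ a\mid n,\ \gcd(a,b)=1,\ 2\le a<b\}$. For $f=\sum f_{ij}x^iy^j\in\overline{\mathcal R}=\mathbb C[x^{\pm1/\mathbf d}][y]$ (with $i\in\frac1{\mathbf d}\mathbb Z$, $j\in\mathbb Z_{\ge0}$): $\mathrm{supp}(f)=\{(i,j):f_{ij}\ne0\}$; $N^0(f)$ is the convex hull of $\mathrm{supp}(f)\cup\{(0,0)\}$; $f^{(0,1)}_k=\sum_i f_{ik}x^iy^k$ is the part of $y$-degree $k$; $\deg(f)$ is the total degree, i.e. the maximum of $i+j$ over $\mathrm{supp}(f)$. $[f,g]=\frac{\partial f}{\partial x}\frac{\partial g}{\partial y}-\frac{\partial f}{\partial y}\frac{\partial g}{\partial x}$ with the usual derivation $\partial x^r/\partial x=rx^{r-1}$. $\mathrm{Rect}_{p,q}=[0,p]\times[0,q]$.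 Let $c\ge2$ be an integer and $p,q$ positive integers with $c\mid p$, $c\mid q$. For $f\in\overline{\mathcal R}$ with $(p,q)\in N^0(f)\subseteq\mathrm{Rect}_{p,q}$ and coefficient of $x^py^q$ equal to $1$, the inner polynomial of $(f,c)$ is $f-Q^c$, where $Q\in\overline{\mathcal R}$ is the unique element with $\mathrm{supp}(Q)\subseteq\mathrm{Rect}_{p/c,q/c}$, coefficient of $x^{p/c}y^{q/c}$ equal to $1$, and $\mathrm{supp}(f-Q^c)\cap\big([\frac{c-1}{c}p,p]\times[\frac{c-1}{c}q,q]\big)=\emptyset$. For a further positive integer $c'$, let $\mathfrak R(p,q;c,c')$ be the set of $(x,y)\in\mathbb R^2$ with $0\le y<\frac{c-1}{c}q$ and $\mathfrak m(x-\frac{c}{c+c'})+\frac{c}{c+c'}\le y\le\frac qp x$, where $\mathfrak m=(q-\frac{c}{c+c'})/(p-\frac{c}{c+c'})$. $\overline T_{p,q;c,c'}$ is the set of $f\in\overline{\mathcal R}$ such that: $(p,q)\in N^0(f)\subseteq\mathrm{Rect}_{p,q}$; $f^{(0,1)}_q=x^py^q$; $f^{(0,1)}_{q-1}=0$; and, with $z$ the inner polynomial of $(f,c)$ and $s=\deg_y(z)$, $z^{(0,1)}_s$ is a monomial (a nonzero constant times some $x^iy^s$) whose support lies in $\mathfrak R(p,q;c,c')$. *)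

(* Defs.v *)
From HB Require Import structures.
From mathcomp Require Import all_boot all_order all_algebra finmap.
From mathcomp Require Import complex.
From mathcomp Require Import boolp classical_sets set_interval reals convex.
From mathcomp Require Import monalg.

Set Implicit Arguments.
Unset Strict Implicit.
Unset Printing Implicit Defensive.

Import Order.TTheory GRing.Theory Num.Theory.

Local Open Scope fset_scope.
Local Open Scope classical_set_scope.
Local Open Scope ring_scope.

(* Laurent polynomials in one variable t with coefficients in K.  The ring     *)
(* structure of {malg K[M]} needs a monoid M without nontrivial invertible     *)
(* elements, so the group algebra K[t, t^-1] is only available there as a      *)
(* module; its multiplication is supplied below.                               *)
Definition laurent (K : comNzRingType) : Type := {malg K[int]}.

HB.instance Definition _ (K : comNzRingType) :=
  GRing.Lmodule.copy (laurent K) {malg K[int]}.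

Section LaurentRing.
Variable K : comNzRingType.
Implicit Types u v w : laurent K.

Definition laurent_one : laurent K := << 1 *g 0 >>.

Definition laurent_mul u v : laurent K :=
  \sum_(k1 <- msupp u) \sum_(k2 <- msupp v) << u@_k1 * v@_k2 *g k1 + k2 >>.

Lemma laurent_mulw (d1 d2 : {fset int}) u v :
  (msupp u `<=` d1)%fset -> (msupp v `<=` d2)%fset ->
  laurent_mul u v =
    \sum_(k1 <- d1) \sum_(k2 <- d2) << u@_k1 * v@_k2 *g k1 + k2 >>.
Proof.
move=> le_d1 le_d2; rewrite /laurent_mul (big_fset_incl _ le_d1) /=.
  apply/eq_bigr => k1 _; apply/big_fset_incl => // k _ /mcoeff_outdom ->.
  by rewrite mulr0 monalgU0.
move=> k _ /mcoeff_outdom uk.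
by rewrite big1 // => k' _; rewrite uk mul0r monalgU0.
Qed.

Lemma laurent_mulC : commutative laurent_mul.
Proof.
move=> u v; rewrite /laurent_mul exchange_big /=.
by apply/eq_bigr => k1 _; apply/eq_bigr => k2 _; rewrite mulrC addrC.
Qed.

Lemma laurent_mulUU (x y : K) (k l : int) :
  laurent_mul << x *g k >> << y *g l >> = << x * y *g k + l >>.
Proof.
by rewrite (laurent_mulw msuppU_le msuppU_le) !big_seq_fset1 !mcoeffUU.
Qed.

Lemma laurent_mul0 : left_zero 0 laurent_mul.
Proof. by move=> u; rewrite /laurent_mul msupp0 big_seq_fset0. Qed.

Lemma laurent_mulDl : left_distributive laurent_mul +%R.
Proof.
move=> u v w.
rewrite [in RHS](laurent_mulw (fsubsetUl _ (msupp v)) (fsubset_refl _)).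
rewrite [in RHS](laurent_mulw (fsubsetUr (msupp u) _) (fsubset_refl _)).
rewrite (laurent_mulw (msuppD_le _ _) (fsubset_refl _)).
rewrite -big_split /=; apply/eq_bigr => k1 _.
rewrite -big_split /=; apply/eq_bigr => k2 _.
by rewrite mcoeffD mulrDl monalgUD.
Qed.

Lemma laurent_mulDr : right_distributive laurent_mul +%R.
Proof.
by move=> u v w; rewrite ![laurent_mul u _]laurent_mulC laurent_mulDl.
Qed.

Lemma laurent_mul_suml (I : Type) (r : seq I) (F : I -> laurent K) v :
  laurent_mul (\sum_(i <- r) F i) v = \sum_(i <- r) laurent_mul (F i) v.
Proof.
exact: (big_morph (laurent_mul^~ v) (fun _ _ => laurent_mulDl _ _ _)
          (laurent_mul0 _)).
Qed.

Lemma laurent_mul_sumr (I : Type) (r : seq I) (F : I -> laurent K) v :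
  laurent_mul v (\sum_(i <- r) F i) = \sum_(i <- r) laurent_mul v (F i).
Proof.
rewrite laurent_mulC laurent_mul_suml.
by apply/eq_bigr => i _; rewrite laurent_mulC.
Qed.

Lemma laurent_mul1 : left_id laurent_one laurent_mul.
Proof.
move=> u; rewrite {1}[u]monalgE laurent_mul_sumr [RHS]monalgE.
by apply/eq_bigr => k _; rewrite laurent_mulUU mul1r add0r.
Qed.

Lemma laurent_mulA : associative laurent_mul.
Proof.
have mulr_sum := laurent_mul_sumr; have mull_sum := laurent_mul_suml.
have mulUU := laurent_mulUU.
move: laurent_mul mulr_sum mull_sum mulUU => mul mulr_sum mull_sum mulUU u v w.
rewrite [u]monalgE !mull_sum; apply/eq_bigr => k1 _.
rewrite [v]monalgE !(mull_sum, mulr_sum); apply/eq_bigr => k2 _.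
rewrite [w]monalgE !(mull_sum, mulr_sum); apply/eq_bigr => k3 _.
by rewrite !mulUU mulrA addrA.
Qed.

Lemma laurent_one_neq0 : laurent_one != 0.
Proof. by rewrite monalgU_eq0 oner_eq0. Qed.

HB.instance Definition _ := GRing.Zmodule_isComNzRing.Build (laurent K)
  laurent_mulA laurent_mulC laurent_mul1 laurent_mulDl laurent_one_neq0.

End LaurentRing.

Section NewtonPolygons.
Variables (R : realType) (d : nat).

(* C[x^{1/d}, x^{-1/d}][y]: the Laurent variable is t = x^{1/d}, so that t^k   *)
(* stands for x^{k/d}, and y is the polynomial variable 'X.  The type does not *)
(* depend on d; everything that refers to exponents of x does.                 *)
Definition Rbar : Type := {poly laurent R[i]}.

Definition plane : Type := (R^o * R^o)%type.

Definition xvar : laurent R[i] := << 1 *g d%:Z >>.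

Definition constR (lam : R[i]) : Rbar := (<< lam *g 0 >> : laurent R[i])%:P.

(* The coefficient of x^p y^q, for integral p. *)
Definition coefxy (f : Rbar) (p q : nat) : R[i] := (f`_q)@_((p * d)%N%:Z).

Definition supp (f : Rbar) : set plane :=
  [set v | exists (k : int) (j : nat),
     (f`_j)@_k != 0 /\ v = (k%:~R / d%:R, j%:R)].

Definition N0 (f : Rbar) : set plane :=
  smallest (@convex_set R _) (supp f `|` [set (0, 0)]).

(* f^{(0,1)}_k *)
Definition ypart (f : Rbar) (k : nat) : Rbar := f`_k *: 'X^k.

Definition degy (f : Rbar) : nat := (size f).-1.

(* The support is finite, so for f != 0 the supremum is a maximum. *)
Definition tdeg (f : Rbar) : R := sup [set v.1 + v.2 | v in supp f].

Definition dxL (u : laurent R[i]) : laurent R[i] :=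
  \sum_(k <- msupp u) << (k%:~R / d%:R) * u@_k *g k - d%:Z >>.

Definition dx (f : Rbar) : Rbar := map_poly dxL f.

Definition dy (f : Rbar) : Rbar := f^`().

Definition jac (f g : Rbar) : Rbar := dx f * dy g - dy f * dx g.

Definition rect (p q : nat) : set plane := `[0, p%:R] `*` `[0, q%:R].

(* z is the inner polynomial of (f, c), for c dividing p and q.  The element Q *)
(* is uniquely determined by the first three conditions: comparing f with Q^c  *)
(* on the upper right rectangle gives the coefficients of Q one after another. *)
Definition is_inner (p q c : nat) (f z : Rbar) : Prop :=
  exists Q : Rbar,
    [/\ supp Q `<=` rect (p %/ c) (q %/ c),
        coefxy Q (p %/ c) (q %/ c) = 1,
        supp (f - Q ^+ c) `&`
          (`[c.-1%:R / c%:R * p%:R, p%:R] `*`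
           `[c.-1%:R / c%:R * q%:R, q%:R]) = set0
      & z = f - Q ^+ c].

Definition region (p q c c' : nat) : set plane :=
  let e : R := c%:R / (c + c')%:R in
  let slope : R := (q%:R - e) / (p%:R - e) in
  [set v | 0 <= v.2 < c.-1%:R / c%:R * q%:R /\
           slope * (v.1 - e) + e <= v.2 <= q%:R / p%:R * v.1].

Definition is_ymonomial (f : Rbar) (s : nat) : Prop :=
  exists (lam : R[i]) (k : int),
    lam != 0 /\ f = (<< lam *g k >> : laurent R[i]) *: 'X^s.

Definition Tbar (p q c c' : nat) : set Rbar :=
  [set f |
    [/\ N0 f (p%:R, q%:R),
        N0 f `<=` rect p q,
        ypart f q = xvar ^+ p *: 'X^q,
        ypart f q.-1 = 0
      & exists2 z : Rbar, is_inner p q c f z &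
          is_ymonomial (ypart z (degy z)) (degy z) /\
          supp (ypart z (degy z)) `<=` region p q c c']].

End NewtonPolygons.

Definition inQ (a b m n : nat) : Prop :=
  [/\ (0 < a)%N, (0 < b)%N, (0 < m)%N & (0 < n)%N] /\
  [/\ (a %| m)%N, (a %| n)%N, coprime a b, (2 <= a)%N & (a < b)%N].

(* Main.v *)
Require Import Defs.
From mathcomp Require Import all_boot all_order all_algebra.
From mathcomp Require Import complex boolp classical_sets reals.
From mathcomp Require Import finmap monalg convex zify ring.

Set Implicit Arguments.
Unset Strict Implicit.
Unset Printing Implicit Defensive.

Import Order.TTheory GRing.Theory Num.Theory.
Local Open Scope classical_set_scope.
Local Open Scope ring_scope.

(** Since n = a divides m, write m = k * a with k > 0.  Then
    F = x^(ka) y^a + 0 * y^(a-1) + lower powers of y, and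
    G = x^(kb) y^b + 0 * y^(b-1) + lower powers of y
    ([Tbar_normalized]).  The claim comes from a stronger one
    ([support_below_diagonal]): every exponent (i, j) in the support of F or
    of G satisfies i <= k * j.  The half-plane v.1 <= k * v.2 is convex and
    contains the origin, so it then contains both Newton polygons, and it
    misses the points (a/(a+b), 0) and (b/(a+b), 0).

    Suppose that some exponent of F or G lies strictly to the right of the line
    i = k * j.  The tops (ka, a) and (kb, b) are on this line.  Rotate it about
    each of them, by the same angle, until the two parallel lines have the
    supports of F and G on their left and at least one of them meets its
    support below the top ([exists_max_slope]).  This gives a weight for which
    the leading forms of F and G have weights proportional to a and b, and at
    least one of the two forms has a term besides its top.  Setting x = 1 in the leading forms loses nothing and gives monic univariate
    polynomials p and q of degrees a and b.  A constant Jacobian has too small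
    a weight to contribute, so the leading forms have Jacobian zero, which by
    the Euler relation reads a p q' = b p' q ([wform_jac]).  For coprime a and
    b this forces p = (X - r)^a and q = (X - r)^b ([power_of_linear_ode]), and
    the vanishing of the coefficient of X^(a-1) gives r = 0.  So neither
    leading form has a second term, a contradiction. *)

(** * A differential equation for univariate polynomials *)

(** If r is a root of p with multiplicity i in p and j in q, comparing the
    lowest terms at r gives a j = b i.  Hence a divides i, so i = a and j = b,
    and the degrees leave no other root. *)
Lemma power_of_linear_ode (C : numClosedFieldType) (a b : nat) (p q : {poly C}) :
  (0 < a)%N -> coprime a b ->
  p \is monic -> q \is monic -> size p = a.+1 -> size q = b.+1 ->
  a%:R * (p * q^`()) = b%:R * (p^`() * q) ->
  exists r : C, p = ('X - r%:P) ^+ a /\ q = ('X - r%:P) ^+ b.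
Proof.
move=> a0 cop mp mq sp sq ode.
have p0 := monic_neq0 mp; have q0 := monic_neq0 mq.
have /closed_rootP [r rp] : size p != 1 by rewrite sp; lia.
have [i [p1 + Ep]] := multiplicity_XsubC p r; rewrite p0 /= => rp1.
have [j [q1 + Eq]] := multiplicity_XsubC q r; rewrite q0 /= => rq1.
set L := 'X - r%:P in Ep Eq *.
have L0 : L != 0 by rewrite polyXsubC_eq0.
(* Multiplying derivatives by L keeps the exponent of L unchanged, so that
   multiplicity 0 (not yet excluded for q) needs no separate case. *)
have dL (h : {poly C}) k :
    L * (h * L ^+ k)^`() = (L * h^`() + k%:R * h) * L ^+ k.
  rewrite derivM deriv_exp derivXsubC mul1r.
  case: k => [|k]; first by rewrite /= mulr0n; ring.
  by rewrite -mulr_natr /= exprS; ring.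
have /(congr1 (horner_eval r)) : a%:R * (p1 * (L * q1^`() + j%:R * q1))
    = b%:R * ((L * p1^`() + i%:R * p1) * q1).
  apply: (mulIf (expf_neq0 (i + j) L0)).
  have E : a%:R * (p * (L * q^`())) = b%:R * ((L * p^`()) * q).
    transitivity (L * (a%:R * (p * q^`()))); first by ring.
    by rewrite ode; ring.
  have {E} := E; rewrite Ep Eq !dL exprD => E.
  by apply: etrans (etrans E _); ring.
rewrite /horner_eval !(hornerE, hornerMn) /= subrr !mul0r !add0r => Er.
have Eij : (a * j = b * i)%N.
  apply/eqP; rewrite -(eqr_nat C).
  have z0 : p1.[r] * q1.[r] != 0 by rewrite mulf_neq0.
  apply/eqP/(mulIf z0); rewrite !natrM.
  by apply: etrans (etrans Er _); ring.
have p10 : p1 != 0 by apply: contraNneq p0 => E; rewrite Ep E mul0r.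
have q10 : q1 != 0 by apply: contraNneq q0 => E; rewrite Eq E mul0r.
have Sp : (size p1 + i = a.+1)%N.
  by rewrite -sp Ep size_Mmonic ?monic_exp ?monicXsubC// size_exp_XsubC addnS.
have Sq : (size q1 + j = b.+1)%N.
  by rewrite -sq Eq size_Mmonic ?monic_exp ?monicXsubC// size_exp_XsubC addnS.
have sp10 : (0 < size p1)%N by rewrite size_poly_gt0.
have i0 : (0 < i)%N.
  by case: i Ep rp {Eij Er Sp} => // Ep; rewrite Ep mulr1 (negPf rp1).
have Ei : i = a.
  have : (a %| b * i)%N by rewrite -Eij dvdn_mulr.
  rewrite Gauss_dvdr// => /dvdn_leq-/(_ i0) ai.
  apply/eqP; rewrite eqn_leq ai andbT -ltnS -Sp.
  by rewrite -[X in (X < _)%N]add0n ltn_add2r.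
have Ej : j = b by apply/eqP; rewrite -(eqn_pmul2l a0) Eij Ei mulnC.
have one (h h1 : {poly C}) k : h \is monic -> h = h1 * L ^+ k -> 
    (size h1 + k = k.+1)%N -> h = L ^+ k.
  move=> mh Eh; rewrite -add1n => /addIn/eqP/size_poly1P[c _ Ec].
  move: mh; rewrite Eh monicMr ?monic_exp ?monicXsubC// Ec.
  by rewrite monicE lead_coefC => /eqP->; rewrite mul1r.
rewrite Ei in Ep Sp; rewrite Ej in Eq Sq.
by exists r; split; [exact: one mp Ep Sp | exact: one mq Eq Sq].
Qed.

Lemma coefPn_XsubC_exp (C : comNzRingType) (r : C) (a : nat) : (0 < a)%N ->
  (('X - r%:P) ^+ a)`_a.-1 = - (r *+ a).
Proof.
move=> a0; have := @coefPn_prod_XsubC C (nseq a r).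
by rewrite !big_nseq size_nseq iter_mulr_1 iter_addr_0; apply; rewrite -lt0n.
Qed.

(** * Coefficients of products and derivatives *)

Lemma coef_laurent_mul (K : comNzRingType) (u v : laurent K) (k : int) :
  (u * v)@_k = \sum_(k1 <- msupp u) u@_k1 * v@_(k - k1).
Proof.
transitivity ((laurent_mul u v)@_k); first by [].
rewrite /laurent_mul raddf_sum /=; apply: eq_bigr => k1 _.
rewrite raddf_sum /= [in v@_(k - k1)](monalgE v) raddf_sum /= mulr_sumr.
apply: eq_bigr => k2 _; rewrite !mcoeffU -mulrnAr.
by congr (_ * (_ *+ _)); congr nat_of_bool; apply/eqP/eqP; lia.
Qed.

Lemma coef_dxL (R : realType) (d : nat) (u : laurent R[i]) (k : int) :
  (dxL d u)@_k = (k + d%:Z)%:~R / d%:R * u@_(k + d%:Z).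
Proof.
rewrite /dxL raddf_sum /= [in RHS](monalgE u) raddf_sum /= mulr_sumr.
apply: eq_bigr => k1 _; rewrite !mcoeffU -mulrnAr.
have -> : (k1 - d%:Z == k) = (k1 == k + d%:Z) by apply/eqP/eqP; lia.
by case: eqP => [->|_] //=; rewrite !mulr0n ?mulr0.
Qed.

Lemma coef_dx (R : realType) (d : nat) (f : Rbar R) (j : nat) (k : int) :
  ((dx d f)`_j)@_k = (k + d%:Z)%:~R / d%:R * (f`_j)@_(k + d%:Z).
Proof.
rewrite /dx coef_map_id0 ?coef_dxL//.
by apply/malgP => l; rewrite coef_dxL !mcoeff0 mulr0.
Qed.

Lemma coef_dy (R : realType) (f : Rbar R) (j : nat) (k : int) :
  ((dy f)`_j)@_k = j.+1%:R * (f`_j.+1)@_k.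
Proof. by rewrite /dy coef_deriv raddfMn /= mulr_natl. Qed.

Lemma coef_xvarX (R : realType) (d p : nat) (k : int) :
  (xvar R d ^+ p)@_k = (k == (d * p)%:Z)%:R.
Proof.
have -> : xvar R d ^+ p = << 1 *g (d * p)%:Z >> :> laurent R[i].
  elim: p => [|p IH]; first by rewrite muln0.
  rewrite exprS IH; apply: etrans (laurent_mulUU _ _ _ _) _.
  by rewrite mulr1 mulnS PoszD.
by rewrite mcoeffU eq_sym.
Qed.

(** * Leading forms with respect to a weight *)

Section LeadingForm.
Variables (R : realType) (d : nat) (u e : int).
Hypothesis u0 : 0 < u.
Implicit Types (f g : Rbar R) (w : int).

(** The weight gives t = x^(1/d) the weight u and y the weight e; e may be
    negative. *)
Definition weight_le w f : Prop :=
  forall (j : nat) (k : int), (f`_j)@_k != 0 -> u * k + e * j%:Z <= w.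

(** As u > 0, at most one monomial of given weight w and given y-degree j
    exists, namely t^((w - e j) / u) y^j; the value is 0 when the exponent is
    not an integer. *)
Definition wcoef w f (j : nat) : R[i] :=
  let k := w - e * j%:Z in if (u %| k)%Z then (f`_j)@_(k %/ u)%Z else 0.

(** The weight-w part of f at x = 1. *)
Definition wform w f : {poly R[i]} := \poly_(j < size f) wcoef w f j.

Lemma wcoefE w f j k : u * k + e * j%:Z = w -> wcoef w f j = (f`_j)@_k.
Proof.
move=> <-; rewrite /wcoef addrK dvdz_mulr ?dvdzz// mulKz//; lia.
Qed.

Lemma wcoefN w f j : (forall k, u * k + e * j%:Z <> w) -> wcoef w f j = 0.
Proof.
move=> H; rewrite /wcoef; case: ifP => // /dvdzP[k E].
by case: (H k); rewrite mulrC -E subrK.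
Qed.

Lemma wcoefP w f j :
  (exists2 k, u * k + e * j%:Z = w & wcoef w f j = (f`_j)@_k) \/
  (forall k, u * k + e * j%:Z <> w) /\ wcoef w f j = 0.
Proof.
have [[k E]|H] := pselect (exists k, u * k + e * j%:Z = w).
  by left; exists k => //; exact: wcoefE.
have H' : forall k, u * k + e * j%:Z <> w by move=> k E; apply: H; exists k.
by right; split => //; exact: wcoefN.
Qed.

Lemma coef_wform w f j : (wform w f)`_j = wcoef w f j.
Proof.
rewrite coef_poly; case: ltnP => // sf; rewrite /wcoef nth_default//.
by rewrite mcoeff0 if_same.
Qed.

Lemma wformD w f g : wform w (f + g) = wform w f + wform w g.
Proof.
apply/polyP => j; rewrite coefD !coef_wform /wcoef coefD mcoeffD.
by case: ifP => // _; rewrite addr0.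
Qed.

Lemma wformN w f : wform w (- f) = - wform w f.
Proof.
apply/polyP => j; rewrite coefN !coef_wform /wcoef coefN mcoeffN.
by case: ifP => // _; rewrite oppr0.
Qed.

(** A product of two monomials reaches the weight w1 + w2 only if both factors
    have their maximal weight. *)
Lemma wformM w1 w2 f g : weight_le w1 f -> weight_le w2 g ->
  wform (w1 + w2) (f * g) = wform w1 f * wform w2 g.
Proof.
move=> wf wg; apply/polyP => l; rewrite coefM coef_wform.
have split_w (k1 k2 : int) (j : nat) : (j <= l)%N ->
    (f`_j)@_k1 * (g`_(l - j))@_k2 != 0 ->
    u * (k1 + k2) + e * l%:Z = w1 + w2 ->
    u * k1 + e * j%:Z = w1 /\ u * k2 + e * (l - j)%:Z = w2.
  move=> jl; rewrite mulf_eq0 negb_or => /andP[/wf H1 /wg H2] E.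
  have El : e * l%:Z = e * j%:Z + e * (l - j)%:Z.
    by rewrite -mulrDr -PoszD subnKC.
  by move: E; rewrite mulrDr El; lia.
have [[k Ek ->]|[Nk ->]] := wcoefP (w1 + w2) (f * g) l.
  rewrite coefM raddf_sum /=; apply: eq_bigr => -[j /= jl] _.
  rewrite coef_laurent_mul !coef_wform.
  have [[k1 E1 ->]|[N1 ->]] := wcoefP w1 f j.
    have El : e * l%:Z = e * j%:Z + e * (l - j)%:Z.
      by rewrite -mulrDr -PoszD subnKC.
    rewrite (@wcoefE w2 g _ (k - k1)); last by rewrite mulrBr; lia.
    have [k1f|k1f] := boolP (k1 \in msupp f`_j); last first.
      rewrite big_seq big1 ?(mcoeff_outdom k1f) ?mul0r// => k2 k2f.
      apply/eqP/contraT => /split_w -/(_ jl); rewrite subrKC => /(_ Ek)[E2 _].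
      by move: k1f; rewrite (_ : k1 = k2) ?k2f//; nia.
    rewrite (big_fsetD1 k1)//= big_seq big1 ?addr0// => k2.
    rewrite in_fsetD1 => /andP[/eqP ne _].
    apply/eqP/contraT => /split_w -/(_ jl); rewrite subrKC => /(_ Ek)[E2 _].
    by case: ne; nia.
  rewrite mul0r big1// => k1 _.
  apply/eqP/contraT => /split_w -/(_ jl); rewrite subrKC => /(_ Ek)[E1 _].
  by case: (N1 _ E1).
rewrite big1// => -[j /= jl] _; rewrite !coef_wform.
have [[k1 E1 ->]|[_ ->]] := wcoefP w1 f j; last by rewrite mul0r.
have [[k2 E2 ->]|[_ ->]] := wcoefP w2 g (l - j); last by rewrite mulr0.
case: (Nk (k1 + k2)); rewrite -E1 -E2.
have -> : l = (j + (l - j))%N by lia.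
by rewrite PoszD addKn; ring.
Qed.

Lemma weight_le_dx w f : weight_le w f -> weight_le (w - u * d%:Z) (dx d f).
Proof.
move=> wf j k; rewrite coef_dx => H.
suff /wf : (f`_j)@_(k + d%:Z) != 0 by rewrite mulrDr; lia.
by apply: contraNneq H => ->; rewrite mulr0.
Qed.

Lemma weight_le_dy w f : weight_le w f -> weight_le (w - e) (dy f).
Proof.
move=> wf j k; rewrite coef_dy => H.
suff /wf : (f`_j.+1)@_k != 0 by rewrite -addn1 PoszD mulrDr; lia.
by apply: contraNneq H => ->; rewrite mulr0.
Qed.

Lemma wform_dy w f : wform (w - e) (dy f) = (wform w f)^`().
Proof.
apply/polyP => j; rewrite coef_deriv !coef_wform -mulr_natl.
rewrite {2}/wcoef /wcoef.
have -> : w - e - e * j%:Z = w - e * j.+1%:Z by rewrite -addn1 PoszD; ring.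
by case: ifP => _; rewrite ?mulr0// coef_dy.
Qed.

(** Euler relation: on monomials of weight w, u d x (d/dx) + e y (d/dy) is
    multiplication by w. *)
Lemma wform_dx w f : (0 < d)%N ->
  (u * d%:Z)%:~R%:P * wform (w - u * d%:Z) (dx d f) =
  w%:~R%:P * wform w f - e%:~R%:P * ('X * (wform w f)^`()).
Proof.
move=> d0; apply/polyP => j; have d0' : d%:R != 0 :> R[i] by rewrite pnatr_eq0 -lt0n.
rewrite coefB !coefCM !coef_wform.
have -> : ('X * (wform w f)^`())`_j = j%:R * wcoef w f j.
  rewrite mulrC coefMX; case: j => [|j] /=; first by rewrite mul0r.
  by rewrite coef_deriv coef_wform mulr_natl.
have [[k Ek ->]|[Nk ->]] := wcoefP w f j.
  rewrite (@wcoefE _ _ _ (k - d%:Z)); last by rewrite mulrBr; lia.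
  rewrite coef_dx subrK -Ek !(intrM, intrD, pmulrn).
  by field.
rewrite wcoefN ?mulr0 ?subr0// => k Ek; apply: (Nk (k + d%:Z)).
by rewrite mulrDr; lia.
Qed.

(** In the products dx f * dy g and dy f * dx g, eliminate dx by the Euler
    relation; the terms in e * X p' q' cancel. *)
Lemma wform_jac w1 w2 f g : (0 < d)%N -> weight_le w1 f -> weight_le w2 g ->
  (u * d%:Z)%:~R%:P * wform (w1 + w2 - u * d%:Z - e) (jac d f g) =
  w1%:~R%:P * (wform w1 f * (wform w2 g)^`())
    - w2%:~R%:P * ((wform w1 f)^`() * wform w2 g).
Proof.
move=> d0 wf wg; rewrite /jac wformD wformN.
have -> : w1 + w2 - u * d%:Z - e = w1 - u * d%:Z + (w2 - e) by ring.
rewrite {1}wformM; [|exact: weight_le_dx|exact: weight_le_dy].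
have -> : w1 - u * d%:Z + (w2 - e) = w1 - e + (w2 - u * d%:Z) by ring.
rewrite wformM; [|exact: weight_le_dy|exact: weight_le_dx].
rewrite !wform_dy.
have := wform_dx w1 f d0; have := wform_dx w2 g d0.
move: (wform (w1 - _) _) (wform (w2 - _) _) => fx gx xg xf.
by rewrite mulrBr mulrA [X in _ - X]mulrCA xf xg; ring.
Qed.
End LeadingForm.

(** * The supporting line through the tops *)

(** A pair (v, u) stands for the slope v / u. *)
Lemma exists_max_slope (s : seq (int * int)) : s != [::] ->
  (forall y, y \in s -> 0 < y.2) ->
  exists2 x, x \in s & forall y, y \in s -> y.1 * x.2 <= x.1 * y.2.
Proof.
elim: s => // x s IH _ pos; have x0 := pos x (mem_head _ _).
have [->|/IH [|m ms mmax]] := eqVneq s [::].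
- by exists x; rewrite ?mem_head// => y; rewrite inE => /eqP->; rewrite mulrC.
- by move=> y ys; apply: pos; rewrite inE ys orbT.
have m0 : 0 < m.2 by apply: pos; rewrite inE ms orbT.
have [le|lt] := leP (x.1 * m.2) (m.1 * x.2).
  exists m; first by rewrite inE ms orbT.
  by move=> y; rewrite inE => /orP[/eqP->//|]; exact: mmax.
exists x; first exact: mem_head.
move=> y; rewrite inE => /orP[/eqP->|ys]; first by rewrite mulrC.
have y0 : 0 < y.2 by apply: pos; rewrite inE ys orbT.
rewrite -(ler_pM2r m0) mulrAC; apply: (@le_trans _ _ (m.1 * y.2 * x.2)).
  by rewrite ler_pM2r// mmax.
by rewrite mulrAC [leRHS]mulrAC ler_pM2r// ltW.
Qed.

Section Normalized.
Variables (R : realType) (d k : nat).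
Implicit Types (f : Rbar R) (a : nat) (u v : int).

Definition normalized a f : Prop :=
  [/\ (size f <= a.+1)%N, f`_a = xvar R d ^+ (k * a) & f`_a.-1 = 0].

(** The pair for a monomial t^K y^j of f consists of its distance to the right
    of the diagonal K = d * k * j and its depth below the top of f. *)
Definition slopes a f : seq (int * int) :=
  [seq (K - (d * k * j)%:Z, a%:Z - j%:Z) | j <- iota 0 a, K <- enum_fset (msupp f`_j)].

Lemma mem_slopes a f j K : (j < a)%N -> (f`_j)@_K != 0 ->
  (K - (d * k * j)%:Z, a%:Z - j%:Z) \in slopes a f.
Proof.
move=> ja fK; apply/allpairsPdep; exists j, K; split => //.
- by rewrite mem_iota.
- by rewrite -mcoeff_neq0.
Qed.

Lemma slopesP a f x : x \in slopes a f -> exists j K,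
  [/\ (j < a)%N, (f`_j)@_K != 0 & x = (K - (d * k * j)%:Z, a%:Z - j%:Z)].
Proof.
move=> /allpairsPdep[j [K [+ KE ->]]]; rewrite mem_iota add0n => /andP[_ ja].
by exists j, K; split => //; rewrite mcoeff_neq0.
Qed.

(** If v / u bounds all slopes, then giving t the weight u and t^(dk) y the
    weight v makes the top of f a monomial of maximal weight. *)
Lemma normalized_weight_le a f u v : normalized a f ->
  (forall y, y \in slopes a f -> y.1 * u <= v * y.2) ->
  weight_le u (v - u * (d * k)%:Z) (v * a%:Z) f.
Proof.
move=> [sf fa _] sl j K fK.
have [ja|aj|ja] := ltngtP j a.
- have /sl /= := mem_slopes ja fK.
  rewrite PoszM mulrBl !mulrBr mulrBl => H; rewrite -subr_ge0.
  by move: H; rewrite -subr_ge0; congr (0 <= _); ring.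
- by move: fK; rewrite nth_default ?mcoeff0 ?eqxx//; apply: leq_trans sf _.
move: fK; rewrite ja fa coef_xvarX mulnA PoszM.
have [-> _|_] := eqVneq K; last by rewrite eqxx.
by rewrite le_eqVlt; apply/orP; left; apply/eqP; ring.
Qed.

Lemma normalized_wform a f u v (e := v - u * (d * k)%:Z)
    (p := wform u e (v * a%:Z) f) : 0 < u -> (0 < a)%N -> normalized a f ->
  [/\ p \is monic, size p = a.+1 & p`_a.-1 = 0].
Proof.
move=> u0 a0 [sf fa fa1].
have pa : p`_a = 1.
  rewrite coef_wform (@wcoefE _ _ _ u0 _ _ _ (d * (k * a))%:Z).
    by rewrite fa coef_xvarX eqxx.
  by rewrite /e !PoszM; ring.
have sp : size p = a.+1.
  apply/eqP; rewrite eqn_leq (leq_trans (size_poly _ _) sf) /= ltnNge.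
  by apply/negP => /leq_sizeP/(_ a (leqnn _))/eqP; rewrite pa oner_eq0.
split => //; first by rewrite monicE lead_coefE sp pa.
by rewrite coef_wform /wcoef fa1 mcoeff0 if_same.
Qed.

End Normalized.

(** Take the weight given by the largest slope v / u.  If v > 0, the leading
    forms of F and G must be X^a and X^b, but the monomial realizing v / u
    contributes a lower term to one of them. *)
Lemma support_below_diagonal (R : realType) (a b d k : nat) (F G : Rbar R)
    (lam : R[i]) :
  (0 < a)%N -> (0 < b)%N -> coprime a b -> (0 < d)%N -> (0 < k)%N ->
  normalized d k a F -> normalized d k b G -> jac d F G = constR lam ->
  (forall j K, (F`_j)@_K != 0 -> K <= (d * k * j)%:Z) /\
  (forall j K, (G`_j)@_K != 0 -> K <= (d * k * j)%:Z).
Proof.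
move=> a0 b0 cab d0 k0 nF nG Ejac.
set s := slopes d k a F ++ slopes d k b G.
have spos y : y \in s -> 0 < y.2.
  by rewrite mem_cat => /orP[] /slopesP[j [K [ja _ ->]]] /=; lia.
suff neg y : y \in s -> y.1 <= 0.
  (* With all slopes at most 0, the weights u = 1, v = 0 express the claim. *)
  have aux c (f : Rbar R) : (0 < c)%N -> normalized d k c f ->
      (forall y, y \in slopes d k c f -> y.1 <= 0) ->
      forall j K, (f`_j)@_K != 0 -> K <= (d * k * j)%:Z.
    move=> c0 nf sl j K fK.
    have : weight_le 1 (0 - 1 * (d * k)%:Z) (0 * c%:Z) f.
      by apply: normalized_weight_le => // y /sl; lia.
    by move=> /(_ _ _ fK); rewrite PoszM; lia.
  by split; [apply: (aux a _ a0 nF) | apply: (aux b _ b0 nG)] => y ys; apply: neg;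
    rewrite mem_cat ys ?orbT.
move=> ys; rewrite leNgt; apply/negP => y1.
have [|[v u] xs xmax] := @exists_max_slope s _ spos; first by case: (s) ys.
have /= u0 := spos _ xs.
have v0 : 0 < v.
  rewrite -(pmulr_lgt0 _ (spos _ ys)); apply: lt_le_trans (xmax _ ys).
  exact: mulr_gt0.
set e := v - u * (d * k)%:Z.
have wF : weight_le u e (v * a%:Z) F.
  by apply: normalized_weight_le => // z zs; apply: (xmax z); rewrite mem_cat zs.
have wG : weight_le u e (v * b%:Z) G.
  by apply: normalized_weight_le => // z zs; apply: (xmax z); rewrite mem_cat zs orbT.
have [mp sp p1] := normalized_wform v u0 a0 nF.
have [mq sq q1] := normalized_wform v u0 b0 nG.
rewrite -/e in mp sp p1 mq sq q1.
have := wform_jac u0 d0 wF wG.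
set p := wform u e _ F in mp sp p1 *; set q := wform u e _ G in mq sq q1 *.
(* The constant has weight 0, and the weight considered here is
   v (a + b - 1) + u d (k - 1) > 0. *)
rewrite Ejac (_ : wform _ _ _ _ = 0); last first.
  apply/polyP => j; rewrite coef_wform coef0.
  have [[K EK ->]|[_ ->//]] := wcoefP e u0 (v * a%:Z + v * b%:Z - u * d%:Z - e) (constR lam) j.
  rewrite coefC; case: eqP => [j0|_]; last by rewrite mcoeff0.
  rewrite mcoeffU; case: eqP => // K0; exfalso; move: EK.
  by rewrite j0 -K0 /e PoszM; nia.
rewrite mulr0 => /esym/eqP; rewrite subr_eq0 !intrM !polyCM -!mulrA => /eqP.
have vC : v%:~R%:P != 0 :> {poly R[i]} by rewrite polyC_eq0 intr_eq0; lia.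
move=> /(mulfI vC); rewrite -!pmulrn !polyC_natr => ode.
have [r [Ep Eq]] := power_of_linear_ode a0 cab mp mq sp sq ode.
have r0 : r = 0.
  apply/eqP; move: p1; rewrite Ep coefPn_XsubC_exp// => /eqP.
  by rewrite oppr_eq0 mulrn_eq0 -[a == 0%N]negbK -lt0n a0.
rewrite r0 subr0 in Ep Eq.
have no c (f : Rbar R) :
    wform u e (v * c%:Z) f = 'X^c -> (v, u) \notin slopes d k c f.
  move=> Ef; apply/negP => /slopesP[j [K [jc fK [Ev Eu]]]].
  have := congr1 (fun h : {poly _} => h`_j) Ef.
  rewrite coef_wform (@wcoefE _ _ _ u0 _ _ _ K); last by rewrite /e Ev Eu !PoszM; ring.
  by rewrite coefXn ltn_eqF//; apply/eqP.
by move: xs; rewrite mem_cat (negPf (no a F Ep)) (negPf (no b G Eq)).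
Qed.

(** * Newton polygons *)

Section Geometry.
Variables (R : realType) (d : nat).
Hypothesis d0 : (0 < d)%N.
Implicit Types (f : Rbar R) (k a : nat).

Lemma Tbar_normalized k a c c' f :
  Tbar d (k * a) a c c' f -> normalized d k a f.
Proof.
move=> [_ sub top sub_top _]; have coefy j (w : laurent R[i]) :
    ypart f j = w *: 'X^j -> f`_j = w.
  by move=> /(congr1 (fun h : Rbar R => h`_j)); rewrite !coefZ coefXn eqxx !mulr1.
split; [|exact: coefy|by apply: coefy; rewrite sub_top scale0r].
apply/leq_sizeP => j aj; apply/malgP => K; rewrite mcoeff0.
apply/eqP; apply: contraTT aj => fK; rewrite -leqNgt -(ler_nat R).
have /sub [_ /=] : N0 d f (K%:~R / d%:R, j%:R).
  by apply: sub_gen_smallest; left; exists K, j.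
by rewrite in_itv /= => /andP[].
Qed.

Lemma N0_below_diagonal k f v :
  (forall j K, (f`_j)@_K != 0 -> K <= (d * k * j)%:Z) ->
  N0 d f v -> v.1 <= k%:R * v.2.
Proof.
move=> diag Nv; suff : [set v : plane R | v.1 <= k%:R * v.2] v by [].
apply: smallest_sub Nv; last first.
  move=> _ [[K [j [fK ->]]]|->] /=; last by rewrite mulr0.
  rewrite ler_pdivrMr ?ltr0n// -natrM -natrM -[leRHS]/((_%:Z)%:~R).
  by rewrite ler_int (le_trans (diag _ _ fK))// lez_nat; lia.
move=> x y t /set_mem /= xs /set_mem /= ys; apply/mem_set => /=.
have t0 : 0 <= interval_inference.Itv.r t by exact: interval_inference.ge0.
have t1 : 0 <= unstable.onem (interval_inference.Itv.r t).
  by apply: unstable.onem_ge0; exact: interval_inference.le1.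
rewrite mulrDr lerD// ![k%:R * (_ *: _)]mulrCA ler_wpM2l//.
Qed.

End Geometry.

Theorem mainTheorem4 (R : realType) (a b m n d : nat) (F G : Rbar R)
  (hQ : inQ a b m n) (hn : n = a) (hd : (0 < d)%N)
  (hjac : exists2 lam : R[i], lam != 0 & jac d F G = constR lam)
  (hF : Tbar d m n a b F)
  (hG : Tbar d (b * m %/ a)%N (b * n %/ a)%N b a G)
  (hsim : N0 d G = [set (b%:R / a%:R : R) *: v | v in N0 d F])
  (hdeg : tdeg d F / tdeg d G = a%:R / b%:R) :
  ~ N0 d F (a%:R / (a + b)%:R, 0) /\ ~ N0 d G (b%:R / (a + b)%:R, 0).
Proof.
case: hQ => [[a0 b0 m0 _] [/dvdnP[k Em] _ cab _ _]].
have k0 : (0 < k)%N by move: m0; rewrite Em muln_gt0 => /andP[].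
move: hF hG; rewrite hn Em mulnA !mulnK// [(b * k)%N]mulnC => hF' hG'.
have nF := Tbar_normalized hF'; have nG := Tbar_normalized hG'.
have [lam _ Ejac] := hjac.
have [dF dG] := support_below_diagonal a0 b0 cab hd k0 nF nG Ejac.
have abs (c : nat) (f : Rbar R) : (0 < c)%N ->
    (forall j K, (f`_j)@_K != 0 -> K <= (d * k * j)%:Z) ->
    ~ N0 d f (c%:R / (a + b)%:R, 0).
  move=> c0 df /(N0_below_diagonal hd df) /=; rewrite mulr0 leNgt divr_gt0//.
    by rewrite ltr0n.
  by rewrite ltr0n addn_gt0 a0.
by split; apply: abs.
Qed.
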